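(* Let $t\in(1,+\infty)$ be a rational number with continued fraction $t=[a_1,a_2,\dots,a_k]$, where $a_i\ge 1$ for all $i$ and $a_k\ge 2$. Then the 0-1 sequence of $t$ in the SC-tree is $$\overline{0\underbrace{0\cdots0}_{a_1-1}1\underbrace{0\cdots0}_{a_2-1}\cdots 1\underbrace{0\cdots0}_{a_{k-1}-1}1\underbrace{0\cdots0}_{a_k-2}}$$ (for $k=1$ this reads $\overline{0\underbrace{0\cdots0}_{a_1-2}}$).
   Context: Let $a,b$ be formal symbols. Consider the infinite binary tree $T$ (the ''S-tree with root $\frac ab$'') whose root is $\frac{a}{b}$ at level 0 and in which every vertex $\frac{u}{v}$ (including the root), where $u,v$ are formal integer linear forms in $a,b$, has left child $\frac{u}{u+v}$ and right child $\frac{v}{u+v}$ in the next level. The two children of a vertex of $T$ have the same denominator, of the form $ma+nb$. The SC-tree is obtained from $T$ by replacing, for each vertex $V$ of $T$, the two children of $V$, whose common denominator is $ma+nb$, by one single vertex $\frac{m}{n}$, placed in the same level as these children; the left (right) child of this SC-vertex is the SC-vertex obtained in the same way from the left (right) child of $V$. Thus level 1 consists of $\frac11$, level 2 of $\frac21,\frac12$ (from left to right), level 3 of $\frac31,\frac32,\frac13,\frac23$, and so on. In addition, two pseudo-fractions $\frac10$ and $\frac01$ are added at level 0, and $\frac11$ is declared to be the right child of $\frac10$ and the left child of $\frac01$. 0-1 sequences in the SC-tree: in level 2, the left vertex $\frac21$ has 0-1 sequence $\overline{0}$ and the right vertex $\frac12$ has 0-1 sequence $\overline{1}$; the 0-1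 sequence of the left (right) child of a vertex is obtained by appending the digit $0$ (respectively $1$) on the right of the 0-1 sequence of that vertex. $[a_1,a_2,\dots,a_k]$ denotes the continued fraction $a_1+\cfrac{1}{a_2+\cfrac{1}{\ddots+\cfrac{1}{a_k}}}$ with positive integer entries. *)

(* Defs.v *)
From mathcomp Require Import all_boot all_order all_algebra.

Set Implicit Arguments.
Unset Strict Implicit.
Unset Printing Implicit Defensive.

Import GRing.Theory.
Local Open Scope ring_scope.

(* The pair (m, n) is the formal linear form m a + n b. *)
Definition linform : Type := (int * int)%type.
Definition form_a : linform := (1, 0).
Definition form_b : linform := (0, 1).
Definition form_add (x y : linform) : linform := (x.1 + y.1, x.2 + y.2).

(* Throughout, directions and digits are booleans: false is left, or the
   digit 0, and true is right, or the digit 1. *)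

(* The pair (u, v) is the formal fraction u / v. *)
Definition T_child (d : bool) (V : linform * linform) : linform * linform :=
  (if d then V.2 else V.1, form_add V.1 V.2).

(* A vertex of T is addressed by the directions leading to it from the root;
   the first direction taken comes first. *)
Definition T_vertex (p : seq bool) : linform * linform :=
  foldl (fun V d => T_child d V) (form_a, form_b) p.

Lemma T_children_denominator (V : linform * linform) :
  (T_child false V).2 = (T_child true V).2.
Proof. by []. Qed.

(* SCnode p is the vertex that replaces the two children of the vertex of T
   addressed by p, so SCnode [::] is the only vertex of level 1. *)
Inductive SC_vertex : Type :=
  | SCpseudo10
  | SCpseudo01
  | SCnode of seq bool.

(* The pair (m, n) is the fraction m / n. By T_children_denominator, either
   child of the vertex of T may be used. *)
Definition SC_frac (v : SC_vertex) : int * int :=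
  match v with
  | SCpseudo10 => (1, 0)
  | SCpseudo01 => (0, 1)
  | SCnode p => (T_child false (T_vertex p)).2
  end.

(* SC_child d u v: v is the child of u in direction d. *)
Inductive SC_child : bool -> SC_vertex -> SC_vertex -> Prop :=
  | SC_child10 : SC_child true SCpseudo10 (SCnode [::])
  | SC_child01 : SC_child false SCpseudo01 (SCnode [::])
  | SC_childN d p : SC_child d (SCnode p) (SCnode (rcons p d)).

(* Sequences are given to the vertices of level at least 2 only: neither 1/1
   nor the pseudo-fractions have one. *)
Inductive SC_sequence : SC_vertex -> seq bool -> Prop :=
  | SC_sequence_level2 d v :
      SC_child d (SCnode [::]) v -> SC_sequence v [:: d]
  | SC_sequence_child d u v w :
      SC_sequence u w -> SC_child d u v -> SC_sequence v (rcons w d).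

(* The condition on the denominator excludes 1/0, since x / 0 = 0 in rat. *)
Definition SC_represents (v : SC_vertex) (t : rat) : Prop :=
  (SC_frac v).2 != 0 /\ (SC_frac v).1%:Q / (SC_frac v).2%:Q = t.

(* s is the 0-1 sequence of t: it is the sequence of a vertex equal to t, and
   no other sequence is. *)
Definition is_SC_sequence_of (t : rat) (s : seq bool) : Prop :=
  forall w : seq bool,
    (exists v : SC_vertex, SC_represents v t /\ SC_sequence v w) <-> w = s.

(* The value at the empty sequence is a dummy. *)
Fixpoint contfrac (a : seq nat) : rat :=
  match a with
  | [::] => 0
  | [:: x] => x%:R
  | x :: a' => x%:R + 1 / contfrac a'
  end.

(* The truncated subtractions are exact on the sequences of interest: all
   entries are at least 1 and the last one is at least 2. *)
Fixpoint contfrac_blocks (a : seq nat) : seq bool :=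
  match a with
  | [::] => [::]
  | [:: x] => nseq (x - 2)%N false
  | x :: a' => nseq (x - 1)%N false ++ true :: contfrac_blocks a'
  end.

Definition contfrac_word (a : seq nat) : seq bool :=
  false :: contfrac_blocks a.

(* Main.v *)
(* Prepending a direction to an address p substitutes (a, a + b) or (b, a + b)
   for (a, b) in the denominator m a + n b below p, so it acts on q = m / n by
   q |-> q + 1 for the digit 0 and by q |-> 1 / (q + 1) for the digit 1. The
   first map has its values above 1, the second below 1, and q = 1 at the empty
   address: an address is therefore determined by its fraction. Reading the
   digits of the given word from the left unfolds the continued fraction. *)
Require Import Defs.
From mathcomp Require Import all_boot all_order all_algebra.
From mathcomp Require Import ring.

Import GRing.Theory Num.Theory Order.Theory.
Local Open Scope ring_scope.

(** Kept in [nat], so that both coefficients are visibly positive and the denominator of an [SCnode]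
    never vanishes. *)
Fixpoint coefs (p : seq bool) : nat * nat :=
  if p is d :: p' then
    let c := coefs p' in
    if d then (c.2, c.1 + c.2)%N else (c.1 + c.2, c.2)%N
  else (1, 1)%N.

(** Stated for an arbitrary root [V] because the first direction replaces the root by one of its
    children. *)
Lemma foldl_T_child_denominator (p : seq bool) (V : linform * linform) :
  (T_child false (foldl (fun V d => T_child d V) V p)).2 =
  ((coefs p).1%:Z * V.1.1 + (coefs p).2%:Z * V.2.1,
   (coefs p).1%:Z * V.1.2 + (coefs p).2%:Z * V.2.2).
Proof.
elim: p V => [|d p IH] V; first by rewrite /= !mul1r.
rewrite [foldl _ _ _]/= IH.
by case: d => /=; congr pair; rewrite PoszD; ring.
Qed.

Lemma SC_frac_node (p : seq bool) :
  SC_frac (SCnode p) = ((coefs p).1%:Z, (coefs p).2%:Z).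
Proof.
rewrite /SC_frac foldl_T_child_denominator /=.
by rewrite !mulr1 !mulr0 addr0 add0r.
Qed.

Lemma coefs_gt0 (p : seq bool) : (0 < (coefs p).1)%N && (0 < (coefs p).2)%N.
Proof.
elim: p => [//|d p /andP[m_gt0 n_gt0]].
by case: d; rewrite /= ?addn_gt0 ?m_gt0 ?n_gt0.
Qed.

Fixpoint address_value (p : seq bool) : rat :=
  if p is d :: p' then
    if d then (1 + address_value p')^-1 else 1 + address_value p'
  else 1.

Lemma address_value_gt0 (p : seq bool) : 0 < address_value p.
Proof.
by elim: p => [//|[] p IH] /=; rewrite ?invr_gt0 addr_gt0.
Qed.

Lemma coefs_ratio (p : seq bool) :
  (coefs p).1%:R / (coefs p).2%:R = address_value p.
Proof.
elim: p => [|d p IH]; first by rewrite /= divr1.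
have /andP[_ n_gt0] := coefs_gt0 p.
have n_neq0 : (coefs p).2%:R != 0 :> rat by rewrite pnatr_eq0 -lt0n.
have shift : (coefs p).1%:R + (coefs p).2%:R
    = (1 + address_value p) * (coefs p).2%:R.
  by rewrite -IH mulrDl mul1r divfK // addrC.
case: d; rewrite /= natrD shift; last by rewrite mulfK.
by rewrite invfM mulrCA divff // mulr1.
Qed.

Lemma SC_represents_node (p : seq bool) (t : rat) :
  SC_represents (SCnode p) t <-> address_value p = t.
Proof.
rewrite /SC_represents SC_frac_node /= -coefs_ratio.
have /andP[_ n_gt0] := coefs_gt0 p.
by split=> [[]|] //; split=> //; rewrite eqz_nat -lt0n.
Qed.

Lemma address_value_inj : injective address_value.
Proof.
have gt1 p : 1 < 1 + address_value p by rewrite ltrDl address_value_gt0.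
have lt1 p : (1 + address_value p)^-1 < 1.
  by rewrite invf_lt1 ?gt1 // (lt_trans ltr01).
elim=> [|d p IH] [|e q] //=.
- by case: e => h; [have := lt1 q | have := gt1 q]; rewrite -h ltxx.
- by case: d => h; [have := lt1 p | have := gt1 p]; rewrite h ltxx.
case: d; case: e => h.
- by rewrite (IH q) //; apply: (addrI 1); apply: invr_inj.
- by have := lt_trans (lt1 p) (gt1 q); rewrite h ltxx.
- by have := lt_trans (lt1 q) (gt1 p); rewrite h ltxx.
- by rewrite (IH q) //; apply: (addrI 1).
Qed.

(** Digits are appended exactly as directions are, so a sequence is the address itself; the empty
    address belongs to 1/1, which has no sequence. *)
Lemma SC_sequence_address (v : SC_vertex) (w : seq bool) :
  SC_sequence v w <-> w <> [::] /\ v = SCnode w.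
Proof.
split=> [|[w_neq0 ->]].
  elim=> {v w} [d v vd|d u v w _ [_ ->] vd]; inversion vd; split=> //.
  by case: (w).
elim/last_ind: w w_neq0 => // w d IH _.
case: w IH => [|e w] IH; first exact: SC_sequence_level2 (SC_childN d [::]).
exact: SC_sequence_child (IH _) (SC_childN _ _).
Qed.

Lemma address_value_nseq_false (n : nat) (p : seq bool) :
  address_value (nseq n false ++ p) = n%:R + address_value p.
Proof.
elim: n => [|n IH]; first by rewrite add0r.
by rewrite /= IH addrA -natr1 (addrC 1).
Qed.

Lemma address_value_contfrac_word (a : seq nat) :
  a <> [::] -> (forall i, (i < size a)%N -> (1 <= nth 0 a i)%N) ->
  (2 <= last 0 a)%N -> address_value (contfrac_word a) = contfrac a.
Proof.
elim: a => [//|x [|y a] IH] _ a_pos a_last.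
  (* The leading digit and the empty address after the block contribute 1 each, which offsets the 2
     in [x - 2]. *)
  rewrite /contfrac_word /= -[nseq _ _]cats0 address_value_nseq_false /=.
  by rewrite natrB //; ring.
have x_gt0 : (1 <= x)%N by exact: (a_pos 0%N).
have {}IH := IH _ (fun i => a_pos i.+1) a_last.
rewrite /contfrac_word [contfrac_blocks _]/= -/(contfrac_blocks (y :: a)).
rewrite [address_value _]/= address_value_nseq_false.
(* The digit 1 inverts 1 plus the value of the remaining blocks. This sum is the value of the tail's
   own word, whose leading 0 also adds 1. *)
rewrite [address_value _]/= [contfrac _]/= -/(contfrac (y :: a)) -IH //.
by rewrite natrB // div1r addrA [1 + (_ - 1)]addrC subrK.
Qed.

Theorem corollary16 (t : rat) (ht : 1 < t)
    (a : seq nat) (ha_nonempty : a <> [::])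
    (ha_pos : forall i : nat, (i < size a)%N -> (1 <= nth 0%N a i)%N)
    (ha_last : (2 <= last 0%N a)%N)
    (hta : t = contfrac a) :
  is_SC_sequence_of t (contfrac_word a).
Proof.
have valE : address_value (contfrac_word a) = t.
  by rewrite hta address_value_contfrac_word.
move=> w; split=> [[v [vt /SC_sequence_address[_ v_w]]]|->].
  (* Uniqueness: two addresses of value [t] coincide. *)
  apply: address_value_inj; rewrite valE.
  by apply/SC_represents_node; rewrite -v_w.
exists (SCnode (contfrac_word a)); split; first exact/SC_represents_node.
exact/SC_sequence_address.
Qed.
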